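(* Let $L_0$ be a normal modal logic over a finite alphabet $\mathrm{Al}$ of modalities which is canonical, pretransitive, and has the ripe cluster property. Then for every extension $L$ of $L_0$ (i.e. every normal logic $L\supseteq L_0$ over $\mathrm{Al}$), $L$ is locally tabular if and only if the height $h(L)$ of $L$ is finite.
   Context: Formulas over a finite alphabet $\mathrm{Al}$ are built from variables $p_0,p_1,\dots$ by Boolean connectives and unary connectives $\Diamond\in\mathrm{Al}$; $\Box\varphi=\neg\Diamond\neg\varphi$. A normal logic over $\mathrm{Al}$ is a set of such formulas containing all classical tautologies, $\neg\Diamond\bot$ and $\Diamond(p_0\vee p_1)\to\Diamond p_0\vee\Diamond p_1$ for each $\Diamond\in\mathrm{Al}$, closed under modus ponens, substitution, and monotonicity ($\varphi\to\psi\in L$ implies $\Diamond\varphi\to\Diamond\psi\in L$). $L$ is $k$-finite if there are only finitely many pairwise $L$-nonequivalent formulas in the variables $p_0,\dots,p_{k-1}$; $L$ is locally tabular if it is $k$-finite for every $k<\omega$. Write $\Diamond_{\mathrm{Al}}\varphi=\bigvee_{\Diamond\in\mathrm{Al}}\Diamond\varphi$ and $\Diamond_{\mathrm{Al}}^{\le m}\varphi=\bigvee_{i\le m}\Diamond_{\mathrm{Al}}^i\varphi$ ($\Diamond^0\varphi=\varphi$). $L$ is $m$-transitive if $\Diamond_{\mathrm{Al}}^{m+1}p\to\Diamond^{\le m}_{\mathrm{Al}}p\in L$; $\mathrm{tra}(L)$ is the least such $m$ ($\omega$ if none), and $L$ is pretransitive if $\mathrm{tra}(L)<\omega$. For pretransitive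 $L$ with $\mathrm{tra}(L)=m$, let $\Diamond^*=\Diamond^{\le m}_{\mathrm{Al}}$, $\Box^*=\neg\Diamond^*\neg$. Let $B_0=\bot$, $B_h=p_h\to\Box(\Diamond p_h\vee B_{h-1})$, and let $B_h^*$ be obtained from $B_h$ by replacing $\Diamond,\Box$ with $\Diamond^*,\Box^*$. The height $h(L)$ is the least $h$ with $B_h^*\in L$, and $h(L)=\omega$ if there is no such $h$ or $L$ is not pretransitive. A Kripke frame $F=(X,(R_\Diamond)_{\Diamond\in\mathrm{Al}})$; $R_F=\bigcup_\Diamond R_\Diamond$, $R_F^*$ its reflexive transitive closure. A cluster of $F$ is an equivalence class of $\{(a,b): aR_F^*b\ \&\ bR_F^*a\}$. For $Y\subseteq X$, $F\restriction Y=(Y,(R_\Diamond\cap(Y\times Y))_\Diamond)$. For a class $\mathcal F$ of Kripke frames, $\mathrm{clust}(\mathcal F)=\{F\restriction C: C$ a cluster of some $F\in\mathcal F\}$. $L$ has the ripe cluster property if, with $\mathcal F$ the class of all Kripke frames validating $L$, the logic (set of formulas valid in all frames) of $\mathrm{clust}(\mathcal F)$ is locally tabular. The canonical frame $F_L$ of $L$ has as points the maximal $L$-consistent sets of formulas (in all countably many variables), with $uR_\Diamond v$ iff $\Diamond\varphi\in u$ for all $\varphi\in v$; $L$ is canonical if every formula of $L$ is valid in $F_L$. *)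

(* Defs.v *)
From mathcomp Require Import all_boot.
From Stdlib Require Import Relation_Operators.

Set Implicit Arguments.
Unset Strict Implicit.
Unset Printing Implicit Defensive.

(* Falsum and implication are the primitive Boolean connectives. *)
Inductive form (Al : Type) : Type :=
| Var of nat
| Bot
| Imp of form Al & form Al
| Dia of Al & form Al.

Arguments Var {Al} _.
Arguments Bot {Al}.

Section Syntax.
Variable Al : finType.
Implicit Types (f g : form Al) (k m h : nat).

Definition Neg f := Imp f Bot.
Definition Top : form Al := Neg Bot.
Definition Or f g := Imp (Neg f) g.
Definition And f g := Neg (Imp f (Neg g)).
Definition Iff f g := And (Imp f g) (Imp g f).

Fixpoint vars_below k f : bool :=
  match f with
  | Var n => n < k
  | Bot => true
  | Imp f1 f2 => vars_below k f1 && vars_below k f2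
  | Dia _ f1 => vars_below k f1
  end.

Fixpoint subst (s : nat -> form Al) f : form Al :=
  match f with
  | Var n => s n
  | Bot => Bot
  | Imp f1 f2 => Imp (subst s f1) (subst s f2)
  | Dia a f1 => Dia a (subst s f1)
  end.

(* Truth value of f when the variables and the formulas starting with a
   diamond are treated as propositional atoms, with values v and w. *)
Fixpoint truth (v : nat -> bool) (w : Al -> form Al -> bool) f : bool :=
  match f with
  | Var n => v n
  | Bot => false
  | Imp f1 f2 => truth v w f1 ==> truth v w f2
  | Dia a f1 => w a f1
  end.

Definition tautology f := forall v w, truth v w f.

(* On the empty alphabet DiaAl f is Bot. *)
Definition DiaAl f : form Al := \big[Or/Bot]_(a : Al) Dia a f.
Definition DiaLe m f : form Al := \big[Or/Bot]_(i < m.+1) iter i DiaAl f.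
Definition BoxLe m f : form Al := Neg (DiaLe m (Neg f)).

(* B_h^*, where Diamond^* is DiaLe m. *)
Fixpoint Bstar m h : form Al :=
  if h is h'.+1 then
    Imp (Var h) (BoxLe m (Or (DiaLe m (Var h)) (Bstar m h')))
  else Bot.

End Syntax.

Arguments Top {Al}.
Arguments Bstar {Al} m h.

Section Logics.
Variable Al : finType.
Implicit Types (L : form Al -> Prop) (f g : form Al) (k m h : nat).

Record normal_logic L : Prop := NormalLogic {
  nl_taut : forall f, tautology f -> L f;
  nl_bot : forall a, L (Neg (Dia a Bot));
  nl_or : forall a, L (Imp (Dia a (Or (Var 0) (Var 1)))
                           (Or (Dia a (Var 0)) (Dia a (Var 1))));
  nl_mp : forall f g, L (Imp f g) -> L f -> L g;
  nl_subst : forall s f, L f -> L (subst s f);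
  nl_mono : forall a f g, L (Imp f g) -> L (Imp (Dia a f) (Dia a g))
}.

(* Finitely many formulas in p_0, ..., p_(k-1) represent all of them up to
   L-equivalence. *)
Definition k_finite L k : Prop :=
  exists n (r : 'I_n -> form Al),
    (forall i, vars_below k (r i)) /\
    (forall f, vars_below k f -> exists i, L (Iff f (r i))).

Definition locally_tabular L : Prop := forall k, k_finite L k.

Definition m_transitive L m : Prop :=
  L (Imp (iter m.+1 (@DiaAl Al) (Var 0)) (DiaLe m (Var 0))).

Definition pretransitive L : Prop := exists m, m_transitive L m.

(* tra(L) = m, for finite m *)
Definition tra_is L m : Prop :=
  m_transitive L m /\ forall m', m' < m -> ~ m_transitive L m'.

(* h(L) = h, for finite h; in particular L is pretransitive. *)
Definition height_is L h : Prop :=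
  exists2 m, tra_is L m &
    L (Bstar m h) /\ forall h', h' < h -> ~ L (Bstar m h').

Definition finite_height L : Prop := exists h, height_is L h.

End Logics.

(* The carrier may be empty: the canonical frame of the inconsistent logic is
   the empty frame. *)
Record frame (Al : Type) := Frame {
  world :> Type;
  acc : Al -> world -> world -> Prop
}.

Section Semantics.
Variable Al : finType.
Implicit Types (F G : frame Al) (FF : frame Al -> Prop) (L : form Al -> Prop).

Fixpoint sat F (V : nat -> F -> Prop) (x : F) (f : form Al) : Prop :=
  match f with
  | Var n => V n x
  | Bot => False
  | Imp f1 f2 => sat V x f1 -> sat V x f2
  | Dia a f1 => exists2 y, acc a x y & sat V y f1
  end.

Definition valid F (f : form Al) : Prop := forall (V : nat -> F -> Prop) x, sat V x f.

Definition validates F L : Prop := forall f, L f -> valid F f.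

Definition logic_of FF (f : form Al) : Prop := forall F, FF F -> valid F f.

Definition reach F : F -> F -> Prop :=
  clos_refl_trans F (fun x y => exists a, acc a x y).

Definition is_cluster F (C : F -> Prop) : Prop :=
  exists a, forall b, C b <-> reach a b /\ reach b a.

Definition restrict F (Y : F -> Prop) : frame Al :=
  @Frame Al {x : F | Y x} (fun a x y => acc a (sval x) (sval y)).

Definition clust FF G : Prop :=
  exists F (C : F -> Prop), [/\ FF F, is_cluster C & G = restrict C].

Definition ripe_cluster_property L : Prop :=
  locally_tabular (logic_of (clust (fun F => validates F L))).

Definition consistent L (u : form Al -> Prop) : Prop :=
  forall n (r : 'I_n -> form Al), (forall i, u (r i)) ->
    ~ L (Neg (\big[@And Al/Top]_(i < n) r i)).

Definition max_consistent L (u : form Al -> Prop) : Prop :=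
  consistent L u /\
  forall v, consistent L v -> (forall f, u f -> v f) -> forall f, v f -> u f.

Definition canonical_frame L : frame Al :=
  @Frame Al {u : form Al -> Prop | max_consistent L u}
    (fun a u v => forall f, sval v f -> sval u (Dia a f)).

Definition canonical L : Prop := validates (canonical_frame L) L.

End Semantics.

(* Main.v *)
(* A normal logic L extending L0 is complete for its canonical model, and the
   canonical frame F_L validates L0, being a generated subframe of F_L0.

   If L has height h, compactness turns B_h^* into a bound on chains of
   clusters of F_L.  Since clusters of L0-frames have a locally tabular logic,
   finitely many formulas define a finite colouring of all clusters at once
   that refines a given colouring and is stable under the accessibility
   relations inside clusters.  Proceeding by depth, and recording at each point
   the colours it sees below its own cluster, one gets a finite stable
   colouring of F_L, whence L is k-finite for all k.

   Conversely, if B_h^* is not in L, then the levels 0, ..., h of the canonical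
   model, given by the failure of B_1^*, B_2^*, ..., are all inhabited.
   Substituting "the level is even" for p_0 makes h+1 formulas in the single
   variable p_0 pairwise distinguishable, so 1-finiteness bounds h. *)

From mathcomp Require Import boolp.
From mathcomp Require classical_sets.
Require Import Defs.
From mathcomp Require Import all_boot.
From Stdlib Require Import Relation_Operators Operators_Properties.

Set Implicit Arguments.
Unset Strict Implicit.
Unset Printing Implicit Defensive.

(** * Boolean valuations on formulas *)

Section BooleanValuations.
Variable Al : finType.
Implicit Types (P : form Al -> Prop) (f g : form Al).

(** Truth assignments, satisfaction at a point and maximal consistent sets are all of this kind, so
    the derived connectives are treated once for all three. *)
Definition bool_hom P : Prop :=
  ~ P Bot /\ forall f g, P (Imp f g) <-> (P f -> P g).

Lemma truth_hom v (w : Al -> form Al -> bool) : bool_hom (fun f => truth v w f).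
Proof. by split=> // f g; split=> [/implyP|/implyP]. Qed.

Lemma sat_hom (F : frame Al) (V : nat -> F -> Prop) x : bool_hom (sat V x).
Proof. by split. Qed.

Variable P : form Al -> Prop.
Hypothesis homP : bool_hom P.

Lemma hom_Bot : P Bot <-> False.
Proof. by split=> // /homP.1. Qed.

Lemma hom_Imp f g : P (Imp f g) <-> (P f -> P g).
Proof. exact: homP.2. Qed.

Lemma hom_Neg f : P (Neg f) <-> ~ P f.
Proof. by rewrite hom_Imp hom_Bot; apply: iff_refl. Qed.

Lemma hom_Top : P Top <-> True.
Proof. by split=> // _; apply/hom_Neg/homP.1. Qed.

Lemma hom_Or f g : P (Or f g) <-> P f \/ P g.
Proof.
rewrite hom_Imp hom_Neg; split=> [fg|[Pf|Pg] //].
by have [Pf|nPf] := EM (P f); [left | right; apply: fg].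
Qed.

Lemma hom_And f g : P (And f g) <-> P f /\ P g.
Proof.
rewrite hom_Neg hom_Imp hom_Neg; split=> [nfg|[Pf Pg]]; last exact.
by split; apply: contrapT => n; apply: nfg.
Qed.

Lemma hom_Iff f g : P (Iff f g) <-> (P f <-> P g).
Proof. by rewrite hom_And !hom_Imp; split=> -[]. Qed.

Lemma hom_bigOr (I : finType) (F : I -> form Al) :
  P (\big[@Or Al/Bot]_(i : I) F i) <-> exists i, P (F i).
Proof.
have -> : (exists i, P (F i)) <-> (exists2 i, i \in index_enum I & P (F i)).
  by split=> [[i Pi]|[i _ Pi]]; exists i; rewrite ?mem_index_enum.
elim: (index_enum I) => [|i s IH].
  by rewrite big_nil hom_Bot; split=> // -[].
rewrite big_cons hom_Or IH; split=> [[Pi|[j js Pj]]|[j]].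
- by exists i; rewrite ?mem_head.
- by exists j; rewrite // in_cons js orbT.
- by rewrite in_cons => /orP[/eqP->|js Pj]; [left | right; exists j].
Qed.

Lemma hom_bigAnd (I : finType) (F : I -> form Al) :
  P (\big[@And Al/Top]_(i : I) F i) <-> forall i, P (F i).
Proof.
have -> : (forall i, P (F i)) <-> (forall i, i \in index_enum I -> P (F i)).
  by split=> Pi i // ; apply: Pi; rewrite mem_index_enum.
elim: (index_enum I) => [|i s IH].
  by rewrite big_nil hom_Top.
rewrite big_cons hom_And IH; split=> [[Pi Ps] j|Pis].
  by rewrite in_cons => /orP[/eqP->|/Ps].
by split=> [|j js]; apply: Pis; rewrite in_cons ?eqxx ?js ?orbT.
Qed.

End BooleanValuations.

(** * Maximal theories *)

Section MaximalTheories.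
Variable Al : finType.
Implicit Types (L T u v : form Al -> Prop) (f g : form Al).

Definition theory L T : Prop :=
  (forall f, L f -> T f) /\ (forall f g, T (Imp f g) -> T f -> T g).

(** Maximal consistency in the form of a Boolean valuation containing [L]; [max_consistentP] proves
    the two notions equivalent for normal [L]. *)
Definition mcs L u : Prop := (forall f, L f -> u f) /\ bool_hom u.

Lemma mcs_sub L L' u : (forall f, L f -> L' f) -> mcs L' u -> mcs L u.
Proof. by move=> LL' [Lu hu]; split=> // f /LL'/Lu. Qed.

Lemma nl_hom L f : normal_logic L -> (forall P, bool_hom P -> P f) -> L f.
Proof. by move=> nL Pf; apply: (nl_taut nL) => v w; apply: (Pf _ (truth_hom v w)). Qed.

(** Lindenbaum's lemma, by Zorn. *)
Lemma maximal_theory_exists L T : normal_logic L -> theory L T -> ~ T Bot ->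
  exists2 u, mcs L u & forall f, T f -> u f.
Proof.
move=> nL [LT mpT] TB.
(* Adjoining [T] makes the union of the empty chain good as well. *)
pose U (X : form Al -> Prop) f := T f \/ X f.
pose good X := theory L (U X) /\ ~ U X Bot.
have [F Fgood Ftot|A [[[LA mpA] AB] maxA]] := @classical_sets.Zorn_bigcup _ good.
  split; last first.
    by case=> // -[X FX XB]; case: (Fgood X FX) => _; apply; right.
  split=> [f /LT|f g]; first by left.
  have FU X Y f' g' : F X -> F Y -> U X (Imp f' g') -> U Y f' ->
      U (classical_sets.bigcup F id) g'.
    move=> FX FY Xfg Yf.
    have [XY|YX] := Ftot X Y FX FY.
      have [[_ mpY] _] := Fgood Y FY.
      have : U Y g' by apply: mpY Yf; case: Xfg; [left | right; apply: XY].
      by case; [left | right; exists Y].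
    have [[_ mpX] _] := Fgood X FX.
    have : U X g' by apply: (mpX _ _ Xfg); case: Yf; [left | right; apply: YX].
    by case; [left | right; exists X].
  case=> [Tfg|[X FX Xfg]] [Tf|[Y FY Yf]].
  - by left; apply: mpT Tf.
  - by apply: (FU Y Y f) => //; [left | right].
  - by apply: (FU X X f) => //; [right | left].
  - by apply: (FU X Y f) => //; right.
have taut f : (forall P, bool_hom P -> P f) -> U A f.
  by move=> ?; apply: LA; apply: nl_hom.
have UK f g : U A g -> U A (Imp f g).
  by apply: mpA; apply: taut => P hP; rewrite !hom_Imp.
have prime f : ~ U A f -> U A (Neg f).
  (* Were [Neg f] missing too, the theory [B] of consequences of [U A] and [f] would be consistent
     and properly extend [A], against maximality. *)
  move=> nAf; pose B g := U A (Imp f g).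
  have UB g : U B g -> B g by case=> // Tg; apply: UK; left.
  apply: contrapT => nAnf; apply: (maxA B); last first.
    split; last by move=> /UB.
    split=> [g /LA Ag|g g' /UB Bgg' /UB Bg]; right; first exact: UK.
    apply: (mpA _ _ _ Bg); apply: (mpA _ _ _ Bgg'); apply: taut => P hP.
    by rewrite !hom_Imp //; auto.
  split=> [g Ag|BA]; first by apply: UK; right.
  by apply: nAf; right; apply: BA; apply: taut => P hP; rewrite hom_Imp.
exists (U A) => [|f]; last by left.
split=> //; split=> // f g; split=> [|fg]; first exact: mpA.
have [/fg Ag|/prime] := EM (U A f); first exact: UK.
by apply: mpA; apply: taut => P hP; rewrite !hom_Imp // hom_Bot.
Qed.

Lemma completeness L f : normal_logic L -> L f <-> forall u, mcs L u -> u f.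
Proof.
move=> nL; split=> [Lf u [Lu _]|allf]; first exact: Lu.
apply: contrapT => nLf.
pose T g := L (Imp (Neg f) g).
have [|TB|u mu Tu] := @maximal_theory_exists L T nL.
- split=> [g|g g' Tgg' Tg].
    by apply: (nl_mp nL); apply: (nl_hom nL) => P hP; rewrite !hom_Imp.
  apply: (nl_mp nL) Tg; apply: (nl_mp nL) Tgg'; apply: (nl_hom nL) => P hP.
  by rewrite !hom_Imp //; auto.
- apply: nLf; apply: (nl_mp nL) TB; apply: (nl_hom nL) => P hP.
  by rewrite !hom_Imp // hom_Bot //; apply: contrapT.
- have /(hom_Neg mu.2) : u (Neg f).
    by apply: Tu; apply: (nl_hom nL) => P hP; rewrite hom_Imp.
  by apply; apply: allf.
Qed.

Lemma consistent_mcs L u : normal_logic L -> consistent L u ->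
  exists2 v, mcs L v & forall f, u f -> v f.
Proof.
move=> nL cu.
pose T g := exists n (r : 'I_n -> form Al), (forall i, u (r i)) /\
  L (Imp (\big[@And Al/Top]_(i < n) r i) g).
have Tu f : u f -> T f.
  move=> uf; exists 1, (fun=> f); split=> //.
  by apply: (nl_hom nL) => P hP; rewrite hom_Imp // hom_bigAnd //; apply; apply: ord0.
have [|TB|v mv Tv] := @maximal_theory_exists L T nL; last by exists v; auto.
  split=> [g Lg|g g' [n [r [ur Lr]]] [m [s [us Ls]]]].
    exists 0, (fun=> Bot); split=> [[]//|].
    by apply: (nl_mp nL) Lg; apply: (nl_hom nL) => P hP; rewrite !hom_Imp.
  exists (n + m), (fun i => match split i with inl j => r j | inr j => s j end).
  split=> [i|]; first by case: (split i).
  apply: (nl_mp nL) Ls; apply: (nl_mp nL) Lr; apply: (nl_hom nL) => P hP.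
  rewrite !hom_Imp // !hom_bigAnd // => rg sg rs.
  have Pr i : P (r i) by have := rs (lshift m i); rewrite (unsplitK (inl _ i)).
  have Ps i : P (s i) by have := rs (rshift n i); rewrite (unsplitK (inr _ i)).
  exact: rg Pr (sg Ps).
by case: TB => n [r [ur Lr]]; apply: (cu n r).
Qed.

Lemma mcs_consistent L u : mcs L u -> consistent L u.
Proof.
move=> [Lu hu] n r ur /Lu; by rewrite hom_Neg // hom_bigAnd.
Qed.

Lemma max_consistentP L u : normal_logic L -> max_consistent L u <-> mcs L u.
Proof.
move=> nL; split=> [[cu maxu]|mu].
  have [v mv uv] := consistent_mcs nL cu.
  suff -> : u = v by [].
  apply: funext => f; apply: propext; split; first exact: uv.
  by apply: (maxu v) => //; apply: mcs_consistent.
split=> [|v cv uv f vf]; first exact: mcs_consistent.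
have [w mw vw] := consistent_mcs nL cv.
apply: contrapT => /(hom_Neg mu.2)/uv/vw/(hom_Neg mw.2); apply.
exact: vw.
Qed.

(* With [S = {f}] this is the existence lemma for [Dia a]; with
   [S = {o f | f in v}] it is the compactness step factoring a composite
   canonical relation. *)
Lemma directed_existence L a u (S : form Al -> Prop) :
  normal_logic L -> mcs L u -> (exists f, S f) ->
  (forall f g, S f -> S g -> exists2 h, S h & L (Imp h (And f g))) ->
  (forall f, S f -> u (Dia a f)) ->
  exists2 w, mcs L w &
    (forall f, S f -> w f) /\ (forall f, w f -> u (Dia a f)).
Proof.
move=> nL mu [s0 Ss0] Sdir SD.
have mono f g : (forall v, mcs L v -> v f -> v g) -> u (Dia a f) -> u (Dia a g).
  move=> fg; apply/(hom_Imp mu.2)/mu.1/(nl_mono nL)/completeness => // v mv.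
  by apply/(hom_Imp mv.2); apply: fg.
have DBot : ~ u (Dia a Bot) by apply/(hom_Neg mu.2)/mu.1/(nl_bot nL).
have Dor f g : u (Dia a (Or f g)) -> u (Dia a f) \/ u (Dia a g).
  move=> uD; apply/(hom_Or mu.2).
  move: uD; apply/(hom_Imp mu.2)/mu.1.
  exact: (nl_subst nL (fun n => if n is 0 then f else g) (nl_or nL a)).
(* [T] collects what some [f] in [S] forces at the [a]-successors of [u]; every maximal extension of
   [T] contains [S] and is a successor of [u]. *)
pose T g := exists2 f, S f & ~ u (Dia a (And f (Neg g))).
have ST f : S f -> T f.
  move=> Sf; exists f => // uD.
  apply: DBot.
  apply: mono uD => v mv; rewrite !(hom_And mv.2) !(hom_Neg mv.2).
  by case.
have [|[f Sf]|w mw Tw] := @maximal_theory_exists L T nL.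
- split=> [g Lg|g g' [f Sf nf] [f' Sf' nf']].
    exists s0 => // uD.
    apply: DBot.
    apply: mono uD => v mv; rewrite !(hom_And mv.2) !(hom_Neg mv.2).
    by case=> _ []; apply: mv.1.
  have [h Sh Lh] := Sdir f f' Sf Sf'; exists h => // uD.
  have : u (Dia a (Or (And f (Neg (Imp g g'))) (And f' (Neg g)))).
    apply: mono uD => v mv.
    have hv := mv.2; have /(hom_Imp hv) := mv.1 _ Lh.
    rewrite (hom_Or hv) !(hom_And hv) !(hom_Neg hv) (hom_Imp hv).
    move=> ff [/ff[vf vf'] ng'].
    have [vg|] := EM (v g); last by right.
    by left; split=> // /(_ vg).
  by case/Dor.
- apply; apply: mono (SD f Sf) => v mv vf.
  by rewrite (hom_And mv.2) (hom_Neg mv.2) (hom_Bot mv.2); split.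
- exists w => //; split=> [f /ST/Tw //|f wf]; apply: contrapT => nuf.
  have /Tw : T (Neg f).
    exists s0 => // uD; apply: nuf; apply: mono uD => v mv.
    rewrite (hom_And mv.2) !(hom_Neg mv.2) => -[_].
    exact: contrapT.
  by rewrite (hom_Neg mw.2).
Qed.

End MaximalTheories.

(** * Reachability and the compound modality *)

Section FrameReach.
Variables (Al : finType) (F : frame Al) (V : nat -> F -> Prop).
Implicit Types (x y z : F) (f g : form Al) (i m : nat).

Lemma reach_refl x : reach x x.
Proof. exact: rt_refl. Qed.

Lemma reach_trans y x z : reach x y -> reach y z -> reach x z.
Proof. exact: rt_trans. Qed.

Lemma reach_step a x y : acc a x y -> reach x y.
Proof. by move=> Rxy; apply: rt_step; exists a. Qed.

Lemma sat_DiaAl x f :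
  sat V x (DiaAl f) <-> exists a, exists2 y, acc a x y & sat V y f.
Proof. exact: (hom_bigOr (sat_hom V x)). Qed.

Lemma sat_DiaLe x m f :
  sat V x (DiaLe m f) <-> exists i : 'I_m.+1, sat V x (iter i (@DiaAl Al) f).
Proof. exact: (hom_bigOr (sat_hom V x)). Qed.

Lemma sat_iter_DiaAl_mono x i f g : (forall y, sat V y f -> sat V y g) ->
  sat V x (iter i (@DiaAl Al) f) -> sat V x (iter i (@DiaAl Al) g).
Proof.
move=> fg; elim: i x => [|i IH] x /=; first exact: fg.
by rewrite !sat_DiaAl => -[a [y Rxy /IH yg]]; exists a, y.
Qed.

Lemma sat_iter_DiaAl_reach x i f : sat V x (iter i (@DiaAl Al) f) ->
  exists2 y, reach x y & sat V y f.
Proof.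
elim: i x => [|i IH] x /=; first by exists x => //; apply: reach_refl.
rewrite sat_DiaAl => -[a [y Rxy /IH[z yz zf]]]; exists z => //.
exact: reach_trans (reach_step Rxy) yz.
Qed.

(** Induction along the path: prepending a step turns a witness at distance [i] into one at distance
    [i.+1], and the hypothesis brings distance [m.+1] back under the bound. *)
Lemma sat_DiaLe_reach m f :
  (forall x, sat V x (Imp (iter m.+1 (@DiaAl Al) f) (DiaLe m f))) ->
  forall x, sat V x (DiaLe m f) <-> exists2 y, reach x y & sat V y f.
Proof.
move=> trm x; split=> [|[y xy]].
  by rewrite sat_DiaLe => -[i /sat_iter_DiaAl_reach].
have {}xy := clos_rt_rt1n _ _ _ _ xy.
elim: x y / xy => [x xf|x z y [a Rxz] _ IH yf].
  by apply/sat_DiaLe; exists ord0.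
case/sat_DiaLe: (IH yf) => i zf.
have xf : sat V x (iter i.+1 (@DiaAl Al) f) by apply/sat_DiaAl; exists a, z.
case: (ltngtP i m) => [im|mi|im].
- by apply/sat_DiaLe; exists (Ordinal (im : i.+1 < m.+1)).
- by have := ltn_ord i; rewrite ltnS leqNgt mi.
- by apply: trm; rewrite -im.
Qed.

Lemma sat_BoxLe_reach m f :
  (forall g x, sat V x (Imp (iter m.+1 (@DiaAl Al) g) (DiaLe m g))) ->
  forall x, sat V x (BoxLe m f) <-> forall y, reach x y -> sat V y f.
Proof.
move=> trm x; rewrite (hom_Neg (sat_hom V x)) sat_DiaLe_reach //.
split=> [nex y xy|allf [y xy]]; last by apply; apply: allf.
by apply: contrapT => nf; apply: nex; exists y.
Qed.

End FrameReach.

(** * Substitutions and bounds on variables *)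

Section Substitution.
Variable Al : finType.
Implicit Types (f : form Al) (s t : nat -> form Al) (k m h : nat).

Lemma subst_DiaAl s f : subst s (DiaAl f) = DiaAl (subst s f).
Proof. by rewrite /DiaAl (big_morph (subst s) (id1 := Bot) (op1 := @Or Al)). Qed.

Lemma subst_iter_DiaAl s i f :
  subst s (iter i (@DiaAl Al) f) = iter i (@DiaAl Al) (subst s f).
Proof. by elim: i => //= i IH; rewrite subst_DiaAl IH. Qed.

Lemma subst_DiaLe s m f : subst s (DiaLe m f) = DiaLe m (subst s f).
Proof.
rewrite /DiaLe (big_morph (subst s) (id1 := Bot) (op1 := @Or Al)) //.
by apply: eq_bigr => i _; rewrite subst_iter_DiaAl.
Qed.

Lemma subst_BoxLe s m f : subst s (BoxLe m f) = BoxLe m (subst s f).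
Proof. by rewrite /BoxLe /= subst_DiaLe. Qed.

Lemma eq_subst s t k f : (forall n, n < k -> s n = t n) ->
  vars_below k f -> subst s f = subst t f.
Proof.
by move=> st; elim: f => //= [f IHf g IHg /andP[/IHf-> /IHg->]|a f IH /IH->].
Qed.

Lemma vars_below_bigOr k (I : Type) (r : seq I) (F : I -> form Al) :
  (forall i, vars_below k (F i)) -> vars_below k (\big[@Or Al/Bot]_(i <- r) F i).
Proof.
by move=> Fk; elim/big_ind: _ => //= f g -> ->.
Qed.

Lemma vars_below_DiaAl k f : vars_below k f -> vars_below k (DiaAl f).
Proof. by move=> fk; apply: vars_below_bigOr. Qed.

Lemma vars_below_DiaLe k m f : vars_below k f -> vars_below k (DiaLe m f).
Proof.
move=> fk; apply: vars_below_bigOr => i.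
by elim: (i : nat) => //= j; apply: vars_below_DiaAl.
Qed.

Lemma vars_below_BoxLe k m f : vars_below k f -> vars_below k (BoxLe m f).
Proof. by move=> fk; rewrite /= vars_below_DiaLe //= fk. Qed.

Lemma vars_below_mono k k' f : k <= k' -> vars_below k f -> vars_below k' f.
Proof.
move=> kk'; elim: f => //= [n /leq_trans|f IHf g IHg /andP[/IHf-> /IHg->]] //.
exact.
Qed.

Lemma vars_below_Bstar m h : vars_below h.+1 (Bstar m h : form Al).
Proof.
elim: h => //= h IH; rewrite ltnSn !vars_below_DiaLe //= vars_below_DiaLe //=.
by rewrite (vars_below_mono _ IH).
Qed.

End Substitution.

(** * The canonical model *)

Section CanonicalModel.
Variables (Al : finType) (L : form Al -> Prop).
Hypothesis nL : normal_logic L.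
Implicit Types (f g : form Al) (m h : nat).

Local Notation W := (canonical_frame L).

Definition cval (n : nat) (u : W) : Prop := sval u (Var n).

Lemma canonical_mcs (u : W) : mcs L (sval u).
Proof. exact/max_consistentP/(svalP u). Qed.

Definition canonical_point u (mu : mcs L u) : W :=
  exist _ u ((max_consistentP u nL).2 mu).

Lemma canonical_eq (u v : W) : (forall f, sval u f -> sval v f) -> u = v.
Proof.
move=> uv; suff : sval u = sval v.
  by case: u v {uv} => [u mu] [v mv]; apply: eq_exist.
apply: funext => f; apply: propext; split; first exact: uv.
have [_ hu] := canonical_mcs u; have [_ hv] := canonical_mcs v.
move=> vf; apply: contrapT => /(hom_Neg hu)/uv/(hom_Neg hv).
exact.
Qed.

Lemma truth_lemma f (u : W) : sat cval u f = sval u f.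
Proof.
apply: propext; elim: f u => [n|| f IHf g IHg|a f IH] u //=.
- by split=> // /(hom_Bot (canonical_mcs u).2).
- by rewrite (hom_Imp (canonical_mcs u).2) IHf IHg.
split=> [[v uv /IH vf]|uf]; first exact: uv.
have [||f1 g1|g|w mw [Sw wu]] := @directed_existence Al L a (sval u) (eq f) nL.
- exact: canonical_mcs.
- by exists f.
- move=> <- <-; exists f => //; apply: nl_hom => // P hP.
  by rewrite hom_Imp // hom_And //; split.
- by move=> <-.
by exists (canonical_point mw) => //; apply/IH/Sw.
Qed.

Lemma canonical_sat f : L f <-> forall u : W, sat cval u f.
Proof.
rewrite completeness //; split=> [Lf u|allf u mu].
  by rewrite truth_lemma; apply: Lf; apply: canonical_mcs.
by have := allf (canonical_point mu); rewrite truth_lemma.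
Qed.

Lemma canonical_subst s f (u : W) : L f -> sat cval u (subst s f).
Proof. by move/(nl_subst nL s)/canonical_sat. Qed.

Lemma canonical_m_transitive m f (u : W) : m_transitive L m ->
  sat cval u (Imp (iter m.+1 (@DiaAl Al) f) (DiaLe m f)).
Proof.
move/(canonical_subst (fun=> f) u).
have substI s g g' : subst s (Imp g g') = Imp (subst s g) (subst s g') by [].
by rewrite substI subst_DiaLe subst_iter_DiaAl.
Qed.

(** Compactness: if every index [i] failed at some [r i] in [P], the conjunction of the [r i] would
    lie in [P] and no index would serve it. *)
Lemma hom_finite_choice (I : finType) (P : form Al -> Prop)
    (Q : I -> form Al -> Prop) : bool_hom P ->
  (forall i f g, (forall P', bool_hom P' -> P' f -> P' g) -> Q i f -> Q i g) ->
  (forall f, P f -> exists i, Q i f) -> exists i, forall f, P f -> Q i f.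
Proof.
move=> hP Qmono exQ; apply: contrapT => nex.
have [i|r rP] := @choice _ _ (fun i f => P f /\ ~ Q i f).
  apply: contrapT => nr; apply: nex; exists i => f Pf.
  by apply: contrapT => nQ; apply: nr; exists f.
have [|i Qi] := exQ (\big[@And Al/Top]_(i : I) r i).
  by apply/hom_bigAnd => // i; apply: (rP i).1.
apply: (rP i).2; apply: Qmono Qi => P' hP'.
by rewrite hom_bigAnd.
Qed.

(** Compactness is used twice: first for a single path length [i] serving all formulas of [v], then,
    at each step, for a single modality [a]. *)
Lemma reach_canonical m (u v : W) :
  (forall f, sval v f -> sval u (DiaLe m f)) -> reach u v.
Proof.
have iter_reach i (w : W) :
    (forall f, sval v f -> sat cval w (iter i (@DiaAl Al) f)) -> reach w v.
  elim: i w => [|i IH] w wv.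
    rewrite [w](_ : _ = v); first exact: reach_refl.
    apply/esym/canonical_eq => f /wv /=.
    by rewrite truth_lemma.
  have [|f /wv/sat_DiaAl[a aw]|a aw] :=
    @hom_finite_choice Al (sval v)
      (fun a f => sat cval w (Dia a (iter i (@DiaAl Al) f))) (canonical_mcs v).2.
  - move=> a f g fg [y Ry yf]; exists y => //.
    by apply: sat_iter_DiaAl_mono yf => z; apply: fg; apply: sat_hom.
  - by exists a.
  (* The next point must satisfy all of [S] in order to lie [i] steps before [v]. [S] is directed
     because [v] is closed under conjunction and iterated diamonds are monotone. *)
  pose S f := exists2 g, sval v g & f = iter i (@DiaAl Al) g.
  have [|f g|f|y my [Sy yw]] := @directed_existence Al L a (sval w) S nL (canonical_mcs w).
  - exists (iter i (@DiaAl Al) Top), Top => //.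
    exact: (hom_Top (canonical_mcs v).2).2.
  - move=> [f' vf ->] [g' vg ->].
    exists (iter i (@DiaAl Al) (And f' g')).
      by exists (And f' g') => //; apply: (hom_And (canonical_mcs v).2 _ _).2.
    apply/canonical_sat => z /= zfg; apply/(hom_And (sat_hom cval z)).
    by split; apply: sat_iter_DiaAl_mono zfg => z' /(hom_And (sat_hom cval z'))[].
  - by case=> g vg ->; rewrite -truth_lemma; apply: aw.
  apply: (reach_trans (y := canonical_point my)).
    exact: (reach_step (a := a)).
  by apply: IH => f vf; rewrite truth_lemma; apply: Sy; exists f.
move=> uv.
have [|f /uv|i iu] := @hom_finite_choice 'I_m.+1 (sval v)
    (fun i f => sat cval u (iter i (@DiaAl Al) f)) (canonical_mcs v).2.
- move=> i f g fg; apply: sat_iter_DiaAl_mono => z; apply: fg.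
  exact: sat_hom.
- by rewrite -truth_lemma sat_DiaLe.
exact: iter_reach iu.
Qed.

End CanonicalModel.

(** Since the canonical frame of [L] is a generated subframe of that of [L0], a valuation on it
    extends by false without changing truth at its points. *)
Lemma canonical_frame_sub (Al : finType) (L0 L : form Al -> Prop) :
  normal_logic L0 -> normal_logic L -> (forall f, L0 f -> L f) ->
  canonical L0 -> validates (canonical_frame L) L0.
Proof.
move=> nL0 nL L0L can f L0f V u.
pose V' n (w : canonical_frame L0) :=
  exists2 u : canonical_frame L, sval u = sval w & V n u.
suff satE g (x : canonical_frame L) (w : canonical_frame L0) :
    sval x = sval w -> sat V' w g <-> sat V x g.
  pose w := canonical_point nL0 (mcs_sub L0L (canonical_mcs nL u)).
  by apply/(satE f u w) => //; apply: can.
elim: g x w => [n|| g IHg g' IHg'|a g IH] x w xw //=.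
- split=> [[x' x'w Vx']|Vx]; last by exists x.
  by rewrite (_ : x = x') //; apply: canonical_eq => // g; rewrite xw x'w.
- by rewrite (IHg x w xw) (IHg' x w xw).
split=> [[y wy yg]|[y xy yg]].
  (* Successors of a point containing [L] contain [L]: if [g'] is in [L], so is
     [Neg (Dia a (Neg g'))]. *)
  have my : mcs L (sval y).
    have [L0y hy] := canonical_mcs nL0 y; split=> // g' Lg'.
    apply: contrapT => /(hom_Neg hy)/wy; rewrite -xw.
    have [Lx hx] := canonical_mcs nL x; apply/(hom_Neg hx)/Lx.
    apply: (nl_mp nL) (nl_bot nL a).
    apply: (nl_mp nL (f := Imp (Dia a (Neg g')) (Dia a Bot))).
      by apply: nl_hom => // P hP; rewrite !(hom_Imp hP); auto.
    apply: (nl_mono nL); apply: (nl_mp nL) Lg'; apply: nl_hom => // P hP.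
    by rewrite !(hom_Imp hP) => Pg; apply.
  exists (canonical_point nL my).
    by move=> g' /wy; rewrite xw.
  exact/(IH (canonical_point nL my) y).
exists (canonical_point nL0 (mcs_sub L0L (canonical_mcs nL y))).
  by move=> g' /xy; rewrite xw.
by apply/(IH y).
Qed.

(** * Finite height implies local tabularity *)

Section Depth.
Variables (Al : finType) (F : frame Al).
Implicit Types x y : F.

(* Every strict chain of clusters starting at [x] has at most [h] members. *)
Fixpoint depth_le h x : Prop :=
  if h is h'.+1 then forall y, reach x y -> reach y x \/ depth_le h' y
  else False.

Lemma depth_le_reach h x y : reach x y -> depth_le h x -> depth_le h y.
Proof.
case: h => // h xy hx z yz; have [zx|] := hx z (reach_trans xy yz); last by right.
by left; apply: reach_trans zx xy.
Qed.

End Depth.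

(** A point [u] violating the bound [h.+1] reaches some [y] that does not reach back and violates
    the bound [h]. A formula [f] true at [u] and not reachable from [y] is substituted for the top
    variable, and [y] refutes the rest by induction. *)
Lemma canonical_depth (Al : finType) (L : form Al -> Prop) m h :
  normal_logic L -> m_transitive L m -> L (Bstar m h) ->
  forall u : canonical_frame L, depth_le h u.
Proof.
move=> nL trm Lh u; apply: contrapT.
suff refute : ~ depth_le h u -> exists s, ~ sat (@cval Al L) u (subst s (Bstar m h)).
  by case/refute => s; apply; apply: canonical_subst.
elim: h u {Lh} => [|h IH] u; first by move=> _; exists Var.
have trW g (x : canonical_frame L) :
    sat (@cval Al L) x (Imp (iter m.+1 (@DiaAl Al) g) (DiaLe m g)).
  exact: canonical_m_transitive.
move=> ndepth; have [y [uy nyu /IH[s ns]]] :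
    exists y, [/\ reach u y, ~ reach y u & ~ depth_le h y].
  apply: contrapT => ny; apply: ndepth => y uy.
  have [|nyu] := EM (@reach Al (canonical_frame L) y u); first by left.
  by right; apply: contrapT => nd; apply: ny; exists y.
have [f [uf nyf]] : exists f, sval u f /\ ~ sval y (DiaLe m f).
  apply: contrapT => nf; apply: nyu; apply: (@reach_canonical Al L nL m) => f uf.
  by apply: contrapT => nyf; apply: nf; exists f.
(* The variables of [Bstar m h] have index at most [h], so this change leaves its instance
   intact. *)
pose t n := if n == h.+1 then f else s n; exists t.
have tE : subst t (Bstar m h) = subst s (Bstar m h).
  apply: eq_subst (vars_below_Bstar Al m h) => n; rewrite /t ltnS => nh.
  by rewrite ltn_eqF.
have -> : subst t (Bstar m h.+1) =
    Imp f (BoxLe m (Or (DiaLe m f) (subst s (Bstar m h)))).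
  rewrite -tE /BoxLe /= subst_DiaLe /= subst_DiaLe /=.
  by rewrite /t eqxx.
move=> H.
have /(sat_BoxLe_reach _ trW) : sat (@cval Al L) u (BoxLe m (Or (DiaLe m f) (subst s (Bstar m h)))).
  by apply: H; move: uf; rewrite -truth_lemma.
move=> /(_ y uy)/(hom_Or (sat_hom _ _))[]; last exact: ns.
by rewrite truth_lemma.
Qed.

(** * Finite colourings stable under accessibility *)

Section TunedColourings.
Variable Al : finType.

(** When [D] is everything, having equal colours is a bisimulation for accessibility; one direction
    suffices because the relation is symmetric. *)
Definition tuned (F : frame Al) (D : F -> Prop) (T : Type) (d : F -> T) : Prop :=
  forall x y a x', D x -> D y -> d x = d y -> acc a x x' ->
    exists2 y', acc a y y' & d y' = d x'.

Lemma tuned_sat (F : frame Al) (T : Type) (d : F -> T) (V : nat -> F -> Prop) k :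
  tuned (fun=> True) d ->
  (forall n x y, n < k -> d x = d y -> V n x -> V n y) ->
  forall f x y, vars_below k f -> d x = d y -> sat V x f <-> sat V y f.
Proof.
move=> td Vd; elim=> [n|| f IHf g IHg|a f IH] x y //=.
- by move=> nk xy; split; apply: Vd.
- by move=> /andP[fk gk] xy; rewrite (IHf x y) // (IHg x y).
have half x1 y1 : vars_below k f -> d x1 = d y1 ->
    (exists2 z, acc a x1 z & sat V z f) -> exists2 z, acc a y1 z & sat V z f.
  move=> fk xy [z xz zf]; have [z' yz' z'z] := td x1 y1 a z I I xy xz.
  by exists z' => //; apply/(IH z z').
by move=> fk xy; split; apply: half.
Qed.

(** A point is coloured by its type, the set of representative formulas true at it. Each type is
    defined by a formula, so types determine which types are seen. *)
Lemma k_finite_tuned (F : frame Al) (Lam : form Al -> Prop) (B : finType)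
    (c : F -> B) : validates F Lam -> k_finite Lam #|B| ->
  exists (T : finType) (e : F -> T),
    tuned (fun=> True) e /\ forall x y, e x = e y -> c x = c y.
Proof.
move=> FLam [n [r [rk rep]]].
(* One variable per colour of [c], so that types refine [c]. *)
pose V j (x : F) := enum_rank (c x) = j :> nat.
pose e x := [set i : 'I_n | `[< sat V x (r i) >]].
have eP x y f : e x = e y -> vars_below #|B| f -> sat V x f -> sat V y f.
  move=> exy /rep[i Li].
  have /(hom_Iff (sat_hom V x))-> := FLam _ Li V x.
  have /(hom_Iff (sat_hom V y))-> := FLam _ Li V y.
  by move/setP: exy => /(_ i); rewrite !inE => exy /asboolP; rewrite exy => /asboolP.
exists {set 'I_n}, e; split=> [x y a x' _ _ exy xx'|x y exy].
  pose phi := \big[@And Al/Top]_(i < n) (if i \in e x' then r i else Neg (r i)).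
  have phiP z : sat V z phi <-> e z = e x'.
    rewrite (hom_bigAnd (sat_hom V z)); split=> [zr|ez i].
      apply/setP => i; have := zr i; rewrite [in RHS]inE [in LHS]inE.
      case: ifP; rewrite inE => -> zi; first exact/asboolP.
      exact/asboolPn.
    by rewrite -ez inE; case: asboolP.
  have [y' yy' /phiP] : sat V y (Dia a phi); last by exists y'.
  apply: (eP x) => //; last by exists x' => //; apply/phiP.
  rewrite /= /phi; elim/big_ind: _ => //= [f g -> -> //|i _].
  by case: ifP => _ /=; rewrite rk.
apply: enum_rank_inj; apply: val_inj => /=; apply/esym.
exact: (eP x y (Var (enum_rank (c x))) exy (ltn_ord _) erefl).
Qed.

(* The disjoint union of the clusters of [F]. *)
Definition cluster_part (F : frame Al) : frame Al :=
  @Frame Al F (fun a x y => acc a x y /\ reach y x).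

(** No arrow of the union leaves a cluster, so truth at a point is computed in its cluster. Using
    the union yields one colouring common to all clusters. *)
Lemma cluster_part_validates (FF : frame Al -> Prop) F :
  FF F -> validates (cluster_part F) (logic_of (clust FF)).
Proof.
move=> FFF f Lf V x.
pose C (y : F) := @reach Al F x y /\ @reach Al F y x.
have CC : is_cluster C by exists x.
have Cx : C x by split; apply: reach_refl.
suff satE g (z : restrict C) : sat (fun n (y : restrict C) => V n (sval y)) z g
    <-> @sat Al (cluster_part F) V (sval z) g.
  by apply/(satE f (exist _ x Cx))/(Lf (restrict C)); exists F, C.
elim: g z => [n|| g IHg g' IHg'|a g IH] z //=.
  by rewrite IHg IHg'.
have [xz zx] := svalP z.
split=> [[y zy /IH yg]|[y [zy yz] yg]].
  exists (sval y) => //; split=> //; have [xy yx] := svalP y.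
  exact: reach_trans yx xz.
have Cy : C y.
  by split; [apply: reach_trans xz (reach_step zy) | apply: reach_trans yz zx].
by exists (exist _ y Cy) => //; apply/IH.
Qed.

(** Induction on [h]: points of depth at most [h] keep their colour; the others are coloured inside
    their clusters by a stable refinement of [b], which joins [c] to the colours already seen among
    shallower successors. *)
Lemma depth_tuned (F : frame Al) (Lam : form Al -> Prop) (B : finType)
    (c : F -> B) h : validates (cluster_part F) Lam -> locally_tabular Lam ->
  exists (T : finType) (d : F -> T), tuned (depth_le h) d /\
    forall x y, depth_le h x -> depth_le h y -> d x = d y -> c x = c y.
Proof.
move=> FLam ltLam; elim: h => [|h [T [d [td cd]]]].
  by exists B, c; split=> [x y a x' []|x y []].
pose D (x : F) := depth_le h x.
pose seen a x := [set t : T | `[< exists2 x', acc a x x' & D x' /\ d x' = t >]].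
pose b x := (c x, [ffun a => seen a x]).
have [T' [e [te be]]] :=
  @k_finite_tuned (cluster_part F) Lam _ b FLam (ltLam #|_|).
pose d' x := if `[< D x >] then inl (d x) else inr (e x) : T + T'.
have d'l x : D x -> d' x = inl (d x) by move=> Dx; rewrite /d' asboolT.
have d'r x : ~ D x -> d' x = inr (e x) by move=> Dx; rewrite /d' asboolF.
exists (T + T')%type, d'; split=> [x y a x' hx hy|x y hx hy].
  have [Dx|nDx] := EM (D x); have [Dy|nDy] := EM (D y).
  - rewrite (d'l x) // (d'l y) // => -[dxy] xx'.
    have [y' yy' dy'] := td x y a x' Dx Dy dxy xx'; exists y' => //.
    have Dx' : D x' := depth_le_reach (reach_step xx') Dx.
    have Dy' : D y' := depth_le_reach (reach_step yy') Dy.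
    by rewrite !d'l // dy'.
  - by rewrite d'l // d'r.
  - by rewrite d'r // d'l.
  rewrite (d'r x) // (d'r y) // => -[exy] xx'.
  (* A successor either stays in the cluster, where [e] is stable, or has depth at most [h], and
     then its colour is recorded in [seen]. *)
  have [x'x|Dx'] := hx x' (reach_step xx').
    have [y' [yy' y'y] ey'] := te x y a x' I I exy (conj xx' x'x).
    have nDx' : ~ D x' by move=> /(depth_le_reach x'x).
    have nDy' : ~ D y' by move=> /(depth_le_reach y'y).
    by exists y' => //; rewrite !d'r // ey'.
  have /(congr1 snd)/ffunP/(_ a)/setP/(_ (d x')) := be x y exy.
  rewrite !ffunE !inE.
  have -> : `[< exists2 x0, acc a x x0 & D x0 /\ d x0 = d x' >].
    by apply/asboolP; exists x'.
  by move/esym/asboolP => [y' yy' [Dy' dy']]; exists y' => //; rewrite !d'l ?dy'.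
have [Dx|nDx] := EM (D x); have [Dy|nDy] := EM (D y).
- by rewrite !d'l // => -[]; apply: cd.
- by rewrite d'l // d'r.
- by rewrite d'r // d'l.
- by rewrite !d'r // => -[/be[]].
Qed.

(** A formula in [k] variables defines a union of colour classes, so one representative per set of
    colours is enough. *)
Lemma k_finite_colouring (L : form Al -> Prop) k (T : finType)
    (d : canonical_frame L -> T) : normal_logic L ->
  (forall f u v, vars_below k f -> d u = d v ->
     sat (@cval Al L) u f <-> sat (@cval Al L) v f) ->
  k_finite L k.
Proof.
move=> nL dP.
pose defines f (S : {set T}) :=
  forall u : canonical_frame L, sat (@cval Al L) u f <-> d u \in S.
have [S|r rP] := @choice {set T} (form Al) (fun S g => vars_below k g /\
    forall f, vars_below k f -> defines f S -> defines g S).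
  have [[f [fk fS]]|nf] := EM (exists f, vars_below k f /\ defines f S).
    by exists f.
  (* [Bot] is a dummy for sets of colours that no such formula defines. *)
  by exists Bot; split=> // f fk fS; case: nf; exists f.
exists #|{: {set T}}|, (fun i => r (enum_val i)); split=> [i|f fk].
  exact: (rP _).1.
pose S := [set t | `[< exists2 u, d u = t & sat (@cval Al L) u f >]].
exists (enum_rank S); rewrite enum_rankK; apply/canonical_sat => // u.
apply/(hom_Iff (sat_hom _ u)).
have fS : defines f S.
  move=> v; rewrite inE; split=> [vf|/asboolP[w wv wf]].
    by apply/asboolP; exists v.
  exact/(dP f w v).
by rewrite (fS u) ((rP S).2 f fk fS u).
Qed.

End TunedColourings.

Lemma finite_height_locally_tabular (Al : finType) (L0 L : form Al -> Prop) :
  normal_logic L0 -> canonical L0 -> ripe_cluster_property L0 ->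
  normal_logic L -> (forall f, L0 f -> L f) ->
  finite_height L -> locally_tabular L.
Proof.
move=> nL0 can ripe nL L0L [h [m [trm _] [Lh _]]] k.
have FL := canonical_frame_sub nL0 nL L0L can.
have depthW := canonical_depth nL trm Lh.
pose c (u : canonical_frame L) := [set n : 'I_k | `[< cval n u >]].
have [T [d [td cd]]] := depth_tuned c h
  (@cluster_part_validates _ (fun F => validates F L0) _ FL) ripe.
apply: (@k_finite_colouring _ L k T d) => // f u v fk duv.
apply: (tuned_sat (k := k) (d := d)) => //.
  by move=> x y a x' _ _; apply: td.
move=> n x y nk dxy.
have /setP/(_ (Ordinal nk)) := cd x y (depthW x) (depthW y) dxy.
by rewrite !inE => exy /asboolP; rewrite exy => /asboolP.
Qed.

(** * Local tabularity implies finite height *)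

Section Levels.
Variables (Al : finType) (F : frame Al) (V : nat -> F -> Prop) (m : nat).
Hypothesis trm :
  forall g x, sat V x (Imp (iter m.+1 (@DiaAl Al) g) (DiaLe m g)).
Implicit Types (x y : F) (i j N : nat).

Definition above i : form Al := DiaLe m (Neg (Bstar m i)).

(* Let the level of a point be the largest [i] with [above i].  At points of
   level at most [N] this formula says that the level is even. *)
Fixpoint even_level N : form Al :=
  if N is N'.+1 then
    if odd N then And (Neg (above N)) (even_level N')
    else Or (above N) (even_level N')
  else Top.

(* When [Var 0] is interpreted as [even_level N] and [j <= N], this says that
   the level is less than [j]. *)
Fixpoint level_lt j : form Al :=
  if j is j'.+1 then
    BoxLe m (Or (if odd j' then Neg (Var 0) else Var 0) (level_lt j'))
  else Bot.

Local Notation holds x f := (sat V x f).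

Lemma aboveP i x : holds x (above i) <-> exists2 y, reach x y & ~ holds y (Bstar m i).
Proof. by rewrite sat_DiaLe_reach. Qed.

Lemma above_reach i x y : reach x y -> holds y (above i) -> holds x (above i).
Proof.
by move=> xy /aboveP[z yz nz]; apply/aboveP; exists z => //; apply: reach_trans yz.
Qed.

(** A failure of [Bstar m i.+1] yields a reachable [z] that refutes [Bstar m i] and sees no point
    with [Var i.+1]. As refuting [Bstar m i.+1] requires that variable, [z] has level exactly
    [i]. *)
Lemma above_succ i x : holds x (above i.+1) ->
  exists y, [/\ reach x y, holds y (above i) & ~ holds y (above i.+1)].
Proof.
have BP y : holds y (Bstar m i.+1) <-> (holds y (Var i.+1) -> forall z, reach y z ->
    holds z (DiaLe m (Var i.+1)) \/ holds z (Bstar m i)).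
  rewrite (hom_Imp (sat_hom V y)) (sat_BoxLe_reach _ trm).
  by split=> H p z yz; apply/(hom_Or (sat_hom V z)); apply: H.
move=> /aboveP[y xy /BP nB].
have [z [yz nD nBz]] : exists z, [/\ reach y z, ~ holds z (DiaLe m (Var i.+1))
    & ~ holds z (Bstar m i)].
  apply: contrapT => nz; apply: nB => _ z yz; apply: contrapT => nor.
  by apply: nz; exists z; split=> // H; apply: nor; [left | right].
exists z; split; first exact: reach_trans yz.
  by apply/aboveP; exists z => //; apply: reach_refl.
move=> /aboveP[w zw /BP nBw]; apply: nBw => pw; case: nD.
by apply/(sat_DiaLe_reach _); [exact: trm | exists w].
Qed.

Lemma above_le i j x : i <= j -> holds x (above j) -> holds x (above i).
Proof.
elim: j => [|j IH]; first by rewrite leqn0 => /eqP->.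
rewrite leq_eqVlt => /orP[/eqP->//|ij /above_succ[y [xy yj _]]].
exact: IH ij (above_reach xy yj).
Qed.

Lemma level_exists i x : holds x (above i) ->
  exists y, [/\ reach x y, holds y (above i) & ~ holds y (above i.+1)].
Proof.
move=> xi; have [/above_succ //|nx] := EM (holds x (above i.+1)).
by exists x; split=> //; apply: reach_refl.
Qed.

(** Conjuncts and disjuncts for levels beyond [i] are neutral at [x]; the one for [i] decides by its
    parity. *)
Lemma even_levelP N i x : i <= N -> holds x (above i) -> ~ holds x (above i.+1) ->
  holds x (even_level N) <-> ~~ odd i.
Proof.
move=> iN xi nxi; elim: N iN => [|N IH].
  by rewrite leqn0 => /eqP->; split=> // _; apply/(hom_Top (sat_hom V x)).
have -> : even_level N.+1 = if odd N.+1 then And (Neg (above N.+1)) (even_level N)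
    else Or (above N.+1) (even_level N) by [].
rewrite leq_eqVlt => /orP[/eqP iN|iN].
  rewrite iN in xi *; case: (odd N.+1).
    by rewrite (hom_And (sat_hom V x)) (hom_Neg (sat_hom V x)); split=> // -[].
  by rewrite (hom_Or (sat_hom V x)); split=> // _; left.
have nN : ~ holds x (above N.+1) by move=> /(above_le (iN : i.+1 <= N.+1)).
rewrite -(IH iN); case: (odd N.+1).
  by rewrite (hom_And (sat_hom V x)) (hom_Neg (sat_hom V x)); split=> [[]|].
by rewrite (hom_Or (sat_hom V x)); split=> [[]|]; [| |right].
Qed.

(** A point above [j.+1] reaches one of level exactly [j.+1], which has the wrong parity for [lit]
    and is not below level [j]. From any other point, a reachable [y] above [j] has level exactly
    [j], which satisfies [lit]. *)
Lemma level_ltP N j x : j <= N ->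
  holds x (subst (fun=> even_level N) (level_lt j)) <-> ~ holds x (above j).
Proof.
elim: j x => [|j IH] x jN.
  split=> // nx; case: nx; apply/aboveP; exists x; first exact: reach_refl.
  by [].
pose lit := if odd j then Neg (even_level N) else even_level N.
have -> : subst (fun=> even_level N) (level_lt j.+1) =
    BoxLe m (Or lit (subst (fun=> even_level N) (level_lt j))).
  by rewrite subst_BoxLe /lit /=; case: (odd j).
have litP i y : i <= N -> holds y (above i) -> ~ holds y (above i.+1) ->
    holds y lit <-> odd i = odd j.
  move=> iN yi nyi; have := even_levelP iN yi nyi; rewrite /lit.
  case: (odd j); first rewrite (hom_Neg (sat_hom V y)).
    by move=> ->; split=> [/negP|->//]; rewrite negbK.
  by move=> ->; split=> [/negbTE|->].
rewrite (sat_BoxLe_reach _ trm); split=> [all /level_exists[y [xy yj nyj]]|nx y xy].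
  have /(hom_Or (sat_hom V y))[|/(IH y (ltnW jN))] := all y xy.
    by move/(litP _ _ jN yj nyj) => /=; case: (odd j).
  by case; apply: above_le yj.
apply/(hom_Or (sat_hom V y)).
have [yj|nyj] := EM (holds y (above j)); last by right; apply/(IH y (ltnW jN)).
left; apply/(litP _ _ (ltnW jN) yj) => //.
by move=> /(above_reach xy).
Qed.

Lemma vars_below_level_lt j : vars_below 1 (level_lt j).
Proof.
by elim: j => // j IH; apply: vars_below_BoxLe => /=; rewrite IH; case: (odd j).
Qed.

End Levels.

(** With [n] representatives, a failure of [Bstar m n] would inhabit the levels 0 to [n] and make
    [n.+1] one-variable formulas inequivalent, against the pigeonhole principle. *)
Lemma one_finite_height (Al : finType) (L : form Al -> Prop) m :
  normal_logic L -> m_transitive L m -> k_finite L 1 -> exists h, L (Bstar m h).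
Proof.
move=> nL trm [n [r [_ rep]]]; apply: contrapT => nB.
have trW g (x : canonical_frame L) :
    sat (@cval Al L) x (Imp (iter m.+1 (@DiaAl Al) g) (DiaLe m g)).
  exact: canonical_m_transitive.
have [u nu] : exists u, ~ sat (@cval Al L) u (Bstar m n).
  apply: contrapT => nu; apply: nB; exists n; apply/canonical_sat => // u.
  by apply: contrapT => nBu; apply: nu; exists u.
have un : sat (@cval Al L) u (above Al m n).
  by apply/aboveP => //; exists u => //; apply: reach_refl.
have [c cP] := @choice 'I_n.+1 'I_n (fun j i => L (Iff (level_lt Al m j) (r i)))
  (fun j => rep _ (vars_below_level_lt Al m j)).
have /leq_card : injective c; last by rewrite !card_ord ltnn.
suff cinj (i j : 'I_n.+1) : i < j -> c i <> c j.
  move=> i j cij; apply: val_inj; case: (ltngtP i j) => // /cinj; first by rewrite cij.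
  by case.
move=> ij cij.
(* A point of level exactly [i] separates the two instances: its level is less than [j] but not less
   than [i]. *)
have [v [_ vi nvi]] := level_exists trW (above_le trW (ltn_ord i : i <= n) un).
have Lij w : sat (@cval Al L) w (subst (fun=> even_level Al m n) (level_lt Al m i))
    <-> sat (@cval Al L) w (subst (fun=> even_level Al m n) (level_lt Al m j)).
  have := canonical_subst nL (fun=> even_level Al m n) w (cP i).
  have := canonical_subst nL (fun=> even_level Al m n) w (cP j).
  move=> /(hom_Iff (sat_hom _ w)) jr /(hom_Iff (sat_hom _ w)) ir.
  by rewrite jr -cij -ir.
have := Lij v; rewrite !(level_ltP trW) -1?ltnS ?ltn_ord // => -[_].
apply=> //.
by move=> /(above_le trW ij).
Qed.

(** Both [tra_is] and [height_is] demand least values of predicates not assumed decidable. *)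
Lemma least_nat (P : nat -> Prop) : (exists n, P n) ->
  exists2 n, P n & forall k, k < n -> ~ P k.
Proof.
move=> exP; have exb : exists n, `[< P n >] by case: exP => n Pn; exists n; apply/asboolP.
case: (ex_minnP exb) => n /asboolP Pn minn; exists n => // k kn /asboolP/minn.
by rewrite leqNgt kn.
Qed.

Lemma locally_tabular_finite_height (Al : finType) (L : form Al -> Prop) :
  normal_logic L -> pretransitive L -> locally_tabular L -> finite_height L.
Proof.
move=> nL /least_nat[m trm minm] lt.
have [h Lh minh] := least_nat (one_finite_height nL trm (lt 1)).
by exists h, m.
Qed.

Theorem theorem5p3 (Al : finType) (L0 : form Al -> Prop)
    (hL0 : normal_logic L0) (hcan : canonical L0) (hpre : pretransitive L0)
    (hripe : ripe_cluster_property L0)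
    (L : form Al -> Prop) (hL : normal_logic L) (hext : forall f, L0 f -> L f) :
  locally_tabular L <-> finite_height L.
Proof.
split; last exact: finite_height_locally_tabular hL0 hcan hripe hL hext.
apply: locally_tabular_finite_height => //.
by case: hpre => m trm; exists m; apply: hext.
Qed.
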